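(* Let $\alpha,\nu$ be positive integers. (a) If $2\alpha<3(\nu+1)$, then $e_1(\alpha,\nu)=\binom{2\nu+1}{2}$ and $E_1(\alpha,\nu)=\{G_{\alpha,\nu}\}$ (up to isomorphism). (b) If $2\alpha>3(\nu+1)$, then $e_1(\alpha,\nu)=\alpha\nu+\binom{\nu}{2}$ and $E_1(\alpha,\nu)=\{H_{\alpha,\nu}\}$ (up to isomorphism). (c) If $2\alpha=3(\nu+1)$, then $e_1(\alpha,\nu)=\binom{2\nu+1}{2}=\alpha\nu+\binom{\nu}{2}$ and $E_1(\alpha,\nu)=\{G_{\alpha,\nu},H_{\alpha,\nu}\}$ (up to isomorphism).
   Context: All graphs are finite and simple; $\alpha(G)$ denotes the independence number and $\nu(G)$ the size of a maximum matching. For positive integers $\alpha,\nu$, let $e_1(\alpha,\nu)=\max\{|E(G)|:\alpha(G)=\alpha,\ \nu(G)=\nu\}$, and let $E_1(\alpha,\nu)$ be the set of graphs $G$ with $\alpha(G)=\alpha$, $\nu(G)=\nu$ and $|E(G)|=e_1(\alpha,\nu)$. $G_{\alpha,\nu}$ is the graph whose components are one $K_{2\nu+1}$ and $\alpha-1$ isolated vertices. $H_{\alpha,\nu}$ is obtained from the complete bipartite graph $K_{\alpha,\nu}$ by adding all $\binom{\nu}{2}$ edges among the vertices of the part of size $\nu$. *)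

(* Defs.v *)
From HB Require Import structures.
From mathcomp Require Import all_boot.

Set Implicit Arguments.
Unset Strict Implicit.
Unset Printing Implicit Defensive.

Record sgraph : Type := SGraph {
  vertex :> finType;
  adj : rel vertex;
  adj_sym : symmetric adj;
  adj_irr : irreflexive adj
}.

Definition edges (G : sgraph) : {set {set G}} :=
  [set e : {set G} | [exists x, exists y, adj x y && (e == [set x; y])]].

Definition independent (G : sgraph) (S : {set G}) : bool :=
  [forall x in S, forall y in S, ~~ adj x y].

Definition matching (G : sgraph) (M : {set {set G}}) : bool :=
  (M \subset edges G) && trivIset M.

Definition indep_num (G : sgraph) : nat :=
  \max_(S : {set G} | independent S) #|S|.

Definition match_num (G : sgraph) : nat :=
  \max_(M : {set {set G}} | matching M) #|M|.

Definition graph_iso (G H : sgraph) : Prop :=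
  exists2 f : G -> H, bijective f & forall x y, adj (f x) (f y) = adj x y.

(* [is_e1 a n m] says e_1(a, n) = m: the maximum, over all finite simple      *)
(* graphs with independence number a and matching number n, of the number of  *)
(* edges exists and equals m.  It is a relation since the class of graphs is  *)
(* not a finite type; such an m is unique when it exists.                     *)
Definition is_e1 (a n m : nat) : Prop :=
  (exists G : sgraph,
      [/\ indep_num G = a, match_num G = n & #|edges G| = m]) /\
  (forall G : sgraph,
      indep_num G = a -> match_num G = n -> #|edges G| <= m).

Definition in_E1 (a n : nat) (G : sgraph) : Prop :=
  [/\ indep_num G = a, match_num G = n & is_e1 a n #|edges G|].

Section ExtremalGraphs.
Variables a n : nat.

(* [inl] is the clique K_(2n+1), [inr] the isolated vertices.                 *)
Definition Gadj : rel ('I_(2 * n + 1) + 'I_(a - 1)) := fun u v =>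
  match u, v with
  | inl x, inl y => x != y
  | _, _ => false
  end.

Lemma Gadj_sym : symmetric Gadj.
Proof. by move=> [x|x] [y|y] //=; rewrite eq_sym. Qed.

Lemma Gadj_irr : irreflexive Gadj.
Proof. by move=> [x|x] //=; rewrite eqxx. Qed.

Definition Ggraph : sgraph := SGraph Gadj_sym Gadj_irr.

(* [inl] is the independent part of size a, [inr] the clique of size n.       *)
Definition Hadj : rel ('I_a + 'I_n) := fun u v =>
  match u, v with
  | inl _, inl _ => false
  | inr x, inr y => x != y
  | _, _ => true
  end.

Lemma Hadj_sym : symmetric Hadj.
Proof. by move=> [x|x] [y|y] //=; rewrite eq_sym. Qed.

Lemma Hadj_irr : irreflexive Hadj.
Proof. by move=> [x|x] //=; rewrite eqxx. Qed.

Definition Hgraph : sgraph := SGraph Hadj_sym Hadj_irr.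

End ExtremalGraphs.

(* Main.v *)
Require Import Defs.
From mathcomp Require Import all_boot.
From mathcomp Require Import zify.

(* By the Tutte-Berge formula there are a set [S] of [s] vertices and a
   partition of the remaining ones into at most [a] blocks, without edges
   between blocks, such that [s + \sum_C |C|./2 <= n].  Counting pairs bounds
   the number of edges by that of the join of [K_s] with a disjoint union of
   [K_(2(n-s)+1)] and [a-1] isolated vertices.  This bound is strictly convex
   in [s], so it is maximal only at [s = 0], the graph [G_(a,n)], or at
   [s = n], the graph [H_(a,n)].

   For the Tutte-Berge formula, take [S] of maximal size with
   [nu(G - S) + |S| <= nu(G)].  Then each vertex outside [S] is missed by some
   maximum matching of [G - S], and Gallai's exchange argument shows that
   "no maximum matching misses both [u] and [v]" is an equivalence relation;
   its classes are the blocks. *)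

Set Implicit Arguments.
Unset Strict Implicit.
Unset Printing Implicit Defensive.

(** * Edges, independent sets and matchings *)

Section Graph.
Variable G : sgraph.
Implicit Types (x y u v t : G) (e f S C W : {set G}) (M N P : {set {set G}}).

Lemma edgesP e :
  reflect (exists x y, adj x y /\ e = [set x; y]) (e \in edges G).
Proof.
rewrite inE; apply: (iffP existsP) => [[x /existsP[y /andP[xy /eqP->]]]|].
  by exists x, y.
by case=> x [y [xy ->]]; exists x; apply/existsP; exists y; rewrite xy eqxx.
Qed.

Lemma mem_edges x y : adj x y -> [set x; y] \in edges G.
Proof. by move=> xy; apply/edgesP; exists x, y. Qed.

Lemma adj_neq x y : adj x y -> x != y.
Proof. by apply: contraTneq => ->; rewrite adj_irr. Qed.

Lemma card_edge e : e \in edges G -> #|e| = 2.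
Proof. by case/edgesP=> x [y [/adj_neq xy ->]]; rewrite cards2 xy. Qed.

Lemma edge_at e x :
  e \in edges G -> x \in e -> exists2 y, adj x y & e = [set x; y].
Proof.
case/edgesP=> u [v [uv ->]]; rewrite !inE => /orP[] /eqP->; first by exists v.
by exists u; rewrite 1?adj_sym // setUC.
Qed.

Lemma independentP S :
  reflect {in S &, forall x y, ~~ adj x y} (independent S).
Proof.
apply: (iffP forall_inP) => [h x y xS yS|h x xS].
  by move/forall_inP: (h x xS); apply.
by apply/forall_inP => y yS; apply: h.
Qed.

Lemma leq_indep_num S : independent S -> #|S| <= indep_num G.
Proof. exact: (@leq_bigmax_cond _ _ (fun S : {set G} => #|S|)). Qed.

Lemma leq_match_num M : matching M -> #|M| <= match_num G.
Proof. exact: (@leq_bigmax_cond _ _ (fun M : {set {set G}} => #|M|)). Qed.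

Lemma matching0 : matching (set0 : {set {set G}}).
Proof. by rewrite /matching sub0set; apply/trivIsetP => A B; rewrite inE. Qed.

Lemma matching_edge M e : matching M -> e \in M -> e \in edges G.
Proof. by case/andP=> /subsetP sM _ /sM. Qed.

Lemma matching_eq M e f x :
  matching M -> e \in M -> f \in M -> x \in e -> x \in f -> e = f.
Proof.
case/andP=> _ tI eM fM xe xf.
by rewrite -(def_pblock tI eM xe) (def_pblock tI fM xf).
Qed.

Lemma matching_sub M N : matching M -> N \subset M -> matching N.
Proof.
case/andP=> sM tI NM; rewrite /matching (subset_trans NM sM).
exact: trivIsetS tI.
Qed.

Lemma card_cover_matching M : matching M -> #|cover M| = 2 * #|M|.
Proof.
move=> mM; have /andP[_ /eqP <-] := mM.
rewrite (eq_bigr (fun=> 2)) ?sum_nat_const ?[_ * 2]mulnC // => e eM.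
exact/card_edge/(matching_edge mM).
Qed.

Lemma matchingU1 M e :
  matching M -> e \in edges G -> [disjoint e & cover M] ->
  matching (e |: M) /\ e \notin M.
Proof.
move=> mM eE dis.
have eM : e \notin M.
  apply/negP => eM; have := card_edge eE.
  suff -> : e = set0 by rewrite cards0.
  apply/eqP; rewrite -(setIidPl (bigcup_sup e eM : e \subset cover M)).
  by rewrite setI_eq0.
split=> //; have /andP[sM tI] := mM.
apply/andP; split; first by rewrite subUset sub1set eE.
apply/trivIsetP => A B; rewrite !inE.
move/trivIsetP: tI => tI.
have d f : f \in M -> [disjoint e & f].
  by move=> fM; apply: disjointWr dis; apply: bigcup_sup.
move=> /orP[/eqP->|AM] /orP[/eqP->|BM]; rewrite ?eqxx // => neq.
- exact: d.
- by rewrite disjoint_sym d.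
- exact: tI.
Qed.

(** * The Tutte-Berge barrier *)

(** These are the matchings of the induced subgraph G - S, kept as edge sets of G so that no graph
    on a subtype has to be formed. *)
Definition avoiding S M := matching M && (cover M \subset ~: S).

Definition avoid_num S := \max_(M | avoiding S M) #|M|.

Definition max_avoiding S M := avoiding S M && (#|M| == avoid_num S).

Lemma max_avoiding_matching S M : max_avoiding S M -> matching M.
Proof. by case/andP=> /andP[]. Qed.

Lemma avoiding0 S : avoiding S set0.
Proof. by rewrite /avoiding matching0 /cover big_set0 sub0set. Qed.

Lemma leq_avoid_num S M : avoiding S M -> #|M| <= avoid_num S.
Proof. exact: (@leq_bigmax_cond _ _ (fun M : {set {set G}} => #|M|)). Qed.

Lemma ex_max_avoiding S : exists M, max_avoiding S M.
Proof.
rewrite /max_avoiding /avoid_num (bigmax_eq_arg set0) ?avoiding0 //.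
case: arg_maxnP => [|M aM _]; first exact: avoiding0.
by exists M; rewrite aM eqxx.
Qed.

(** Otherwise the edge xy could be added to [M], giving a larger matching of G - S. *)
Lemma max_avoiding_adj S M x y :
  max_avoiding S M -> x \notin S -> y \notin S -> adj x y ->
  x \notin cover M -> y \notin cover M -> False.
Proof.
case/andP=> /andP[mM dM] /eqP cM xS yS xy xM yM.
have [||mM' eM] := matchingU1 (e := [set x; y]) mM.
- exact: mem_edges.
- by rewrite disjoints_subset subUset !sub1set !inE xM.
have : avoiding S ([set x; y] |: M).
  rewrite /avoiding mM' /cover bigcup_setU big_set1 !subUset dM andbT.
  by rewrite !sub1set !inE xS.
by move/leq_avoid_num; rewrite cardsU1 eM -cM ltnn.
Qed.

(** Gallai's relation for G - S. The equality disjunct supplies reflexivity: a vertex missed by some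
    maximum matching is not related to itself by the second disjunct. *)
Definition linked S u v :=
  (u == v) || [forall M, max_avoiding S M ==>
                 ((u \in cover M) || (v \in cover M))].

Lemma linkedP S u v :
  reflect (u = v \/ forall M, max_avoiding S M ->
                      u \notin cover M -> v \in cover M)
          (linked S u v).
Proof.
apply: (iffP orP) => -[/eqP|h]; [by left|right|by left|right].
  by move=> M maxM uM; have /implyP/(_ maxM) := forallP h M; rewrite (negPf uM).
by apply/forallP => M; apply/implyP => /h; case: (u \in cover M) => //; apply.
Qed.

Lemma linked_refl S u : linked S u u.
Proof. by rewrite /linked eqxx. Qed.

Lemma linked_sym S : symmetric (linked S).
Proof.
move=> u v; rewrite /linked eq_sym; congr (_ || _).
by apply: eq_forallb => M; rewrite orbC.
Qed.

Lemma adj_linked S x y : x \notin S -> y \notin S -> adj x y -> linked S x y.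
Proof.
move=> xS yS xy; apply/linkedP; right => M maxM xM.
by apply/negPn/negP => yM; apply: (max_avoiding_adj maxM xS yS xy xM yM).
Qed.

(* Gallai's exchange argument: among the maximum matchings missing [t], one
   that shares the most edges with [M] can still be improved. *)
Lemma linked_trans S u t v :
  (exists2 N, max_avoiding S N & t \notin cover N) ->
  linked S u t -> linked S t v -> linked S u v.
Proof.
case=> N0 maxN0 tN0 /linkedP[->//|ut] /linkedP[<-|tv].
  by apply/linkedP; right.
have [->|uv] := eqVneq u v; first exact: linked_refl.
apply/linkedP; right => M maxM uM; apply/negPn/negP => vM.
pose Q N := max_avoiding S N && (t \notin cover N).
have QN0 : Q N0 by apply/andP.
case: (arg_maxnP (fun N => #|M :&: N|) QN0) => N /andP[maxN tN] best.
have uN : u \in cover N.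
  by apply: contraNT tN => /(ut _ maxN).
have vN : v \in cover N by apply: tv.
have mM := max_avoiding_matching maxM; have mN := max_avoiding_matching maxN.
(* [u] and [v] are covered by [N] but not by [M]. Both covers have the same size, so at least two
   vertices are covered by [M] but not by [N], and one of them differs from [t]. *)
have [x [xM xN xt]] : exists x, [/\ x \in cover M, x \notin cover N & x != t].
  have cMN : #|cover M| = #|cover N|.
    rewrite !card_cover_matching //.
    by case/andP: maxM => _ /eqP->; case/andP: maxN => _ /eqP->.
  have c2 : 1 < #|cover N :\: cover M|.
    have <- : #|[set u; v]| = 2 by rewrite cards2 uv.
    apply: subset_leq_card; rewrite subUset !sub1set !inE.
    by rewrite uM vM uN vN.
  have : 1 < #|cover M :\: cover N|.
    by move: c2; rewrite !cardsD setIC cMN.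
  rewrite (cardsD1 t) => c1.
  have /card_gt0P[x] : 0 < #|(cover M :\: cover N) :\ t|.
    by move: c1; case: (t \in _); lia.
  by rewrite !inE => /and3P[*]; exists x.
have /bigcupP[e eM xe] := xM.
have eE := matching_edge mM eM.
have [y xy def_e] := edge_at eE xe.
have out z f : max_avoiding S M -> f \in M -> z \in f -> z \notin S.
  case/andP=> /andP[_ dM] _ fM zf.
  by rewrite -in_setC (subsetP dM) //; apply/bigcupP; exists f.
have xS : x \notin S by apply: (out x e).
have yS : y \notin S by apply: (out y e) => //; rewrite def_e set22.
have yN : y \in cover N.
  by apply/negPn/negP => /(max_avoiding_adj maxN xS yS xy xN).
have /bigcupP[f fN yf] := yN.
have eN : e \notin N.
  by apply: contra xN => eN; apply/bigcupP; exists e.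
have fM : f \notin M.
  apply/negP => fM; move/negP: eN; apply.
  suff -> : e = f by [].
  by apply: (matching_eq mM eM fM (x := y)); rewrite // def_e set22.
have mNf : matching (N :\ f) by apply: matching_sub mN _; apply: subsetDl.
have sub_cover : cover (N :\ f) \subset cover N.
  by apply/bigcupsP => g /setD1P[_ gN]; apply: bigcup_sup.
(* Trading [f] for [e] in [N] keeps the size and still misses [t]: [x] was chosen different from
   [t], and [y] is covered by [N] while [t] is not. *)
have [||mN' _] := matchingU1 (e := e) mNf => //.
  rewrite disjoints_subset def_e subUset !sub1set !inE.
  rewrite (contra (subsetP sub_cover x) xN) /=.
  apply/bigcupP => -[g /setD1P[gf gN] yg]; move/eqP: gf; apply.
  exact: (matching_eq mN gN fN yg yf).
have cN' : #|e |: (N :\ f)| = #|N|.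
  by rewrite cardsU1 !inE (negPf eN) andbF /= (cardsD1 f N) fN.
have cover' : cover (e |: (N :\ f)) = e :|: cover (N :\ f).
  by rewrite /cover bigcup_setU big_set1.
have QN' : Q (e |: (N :\ f)).
  case/andP: (maxN) => /andP[_ dN] cN.
  rewrite /Q /max_avoiding /avoiding mN' cN' cN cover' /= andbT.
  rewrite subUset (subset_trans sub_cover) // andbT.
  rewrite {1}def_e subUset !sub1set !inE xS yS /=.
  rewrite negb_or (contra (subsetP sub_cover t) tN) andbT def_e !inE.
  rewrite negb_or eq_sym xt /=; apply: contraNneq tN => ->; exact: yN.
(* As [f] is not in [M], the trade loses no common edge with [M] and gains [e], against the choice
   of [N]. *)
have := best _ QN'; apply/negP; rewrite -ltnNge.
have <- : e |: (M :&: N) = M :&: (e |: (N :\ f)).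
  apply/setP => g; rewrite !inE.
  have [->|_] := eqVneq g e; first by rewrite eM.
  by have [->|//] := eqVneq g f; rewrite (negPf fM).
by rewrite cardsU1 !inE (negPf eN) andbF.
Qed.

Lemma avoid_num0 : avoid_num set0 = match_num G.
Proof.
by apply: eq_bigl => M; rewrite /avoiding setC0 subsetT andbT.
Qed.

Lemma sum_card_setI P W C : partition P W ->
  \sum_(D in P) #|D :&: C| = #|W :&: C|.
Proof.
move=> partP; rewrite -sum1_card.
rewrite (eq_bigl (fun x => (x \in W) && (x \in C))) => [|x]; last by rewrite inE.
rewrite (set_partition_big_cond _ partP); apply: eq_bigr => D _.
by rewrite -sum1_card; apply: eq_bigl => x; rewrite inE.
Qed.

Lemma tutte_berge_barrier : exists S P,
  [/\ partition P (~: S),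
      {in ~: S &, forall x y, adj x y -> pblock P x = pblock P y}
    & #|S| + \sum_(C in P) #|C|./2 <= match_num G].
Proof.
pose Q S := avoid_num S + #|S| <= match_num G.
have Q0 : Q set0 by rewrite /Q avoid_num0 cards0 addn0.
case: (arg_maxnP (fun S => #|S|) Q0) => S QS best.
(* If every maximum matching of G - S covered [v], deleting [v] would lower the matching number by
   at least one, so [v |: S] would satisfy [Q] and be larger than [S]. *)
have missed v : v \in ~: S -> exists2 N, max_avoiding S N & v \notin cover N.
  rewrite inE => vS.
  have [N /andP[/andP[mN dN] /eqP cN]] := ex_max_avoiding (v |: S).
  have vN : v \notin cover N.
    by apply/negP => /(subsetP dN); rewrite !inE eqxx.
  exists N => //.
  have aN : avoiding S N 
    by rewrite /avoiding mN (subset_trans dN) // setCS subsetU1.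
  rewrite /max_avoiding aN eqn_leq leq_avoid_num //= cN leqNgt.
  apply/negP => lt; have /best : Q (v |: S).
    by move: QS; rewrite /Q cardsU1 vS; lia.
  by rewrite /= cardsU1 vS; lia.
have eqv : {in ~: S & &, equivalence_rel (linked S)}.
  move=> x y z xS yS zS; split; first exact: linked_refl.
  move=> xy; apply/idP/idP; apply: linked_trans => //; try exact: missed.
  by rewrite linked_sym.
set P := equivalence_partition (linked S) (~: S).
have partP : partition P (~: S) by apply: equivalence_partitionP.
have pb x y : x \in ~: S -> y \in ~: S ->
    (y \in pblock P x) = linked S x y.
  exact: pblock_equivalence_partition.
have tI := partition_trivIset partP.
exists S, P; split=> //.
  move=> x y xS yS xy; symmetry; apply: same_pblock => //.
  by rewrite pb //; apply: adj_linked; rewrite -?in_setC // adj_sym.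
have [M maxM] := ex_max_avoiding S.
have mM := max_avoiding_matching maxM.
have coverS : cover M \subset ~: S.
  by case/andP: maxM => /andP[].
suff le : \sum_(C in P) #|C|./2 <= #|M|.
  by rewrite addnC (leq_trans _ QS) // leq_add2r; case/andP: maxM => _ /eqP <-.
rewrite -(leq_pmul2l (isT : 0 < 2)) -card_cover_matching //.
rewrite -(setIidPr coverS) -(sum_card_setI _ partP) big_distrr /=.
apply: leq_sum => C CP.
have CS x : x \in C -> x \in ~: S := subsetP (partitionS partP CP) x.
(* The ends of an edge of [M] are linked, so such an edge lies inside one block. Hence the part of
   [C] covered by [M] is the cover of a matching and has even size. *)
pose MC := [set e in M | e \subset C].
have eqC : C :&: cover M = cover MC.
  apply/setP => x; rewrite inE; apply/andP/bigcupP => [[xC /bigcupP[e eM xe]]|].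
    exists e => //; rewrite inE eM.
    have [y xy def_e] := edge_at (matching_edge mM eM) xe.
    have yS : y \in ~: S.
      apply: (subsetP coverS); apply/bigcupP; exists e => //.
      by rewrite def_e set22.
    have xS := CS x xC.
    rewrite def_e subUset !sub1set xC -(def_pblock tI CP xC) pb //.
    by apply: adj_linked; rewrite -?in_setC.
  case=> e; rewrite inE => /andP[eM eC] xe; split; first exact: (subsetP eC).
  by apply/bigcupP; exists e.
rewrite eqC.
have mMC : matching MC 
  by apply: matching_sub mM _; apply/subsetP => e; rewrite inE => /andP[].
(* Two distinct linked vertices are never both missed by the maximum matching [M]. *)
have cD : #|C :\: cover M| <= 1.
  apply/card_le1_eqP => x y /setDP[xC xM] /setDP[yC yM].
  have : linked S x y by rewrite -pb ?CS // (def_pblock tI CP xC).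
  by case/linkedP=> // /(_ M maxM xM); rewrite (negPf yM).
have := cardsID (cover M) C.
by rewrite eqC !card_cover_matching //; lia.
Qed.

End Graph.

(** * Counting edges *)

Section Count.
Variable G : sgraph.
Implicit Types (x y u v t : G) (e f S C W : {set G}) (M N P : {set {set G}}).

(** Counting ordered pairs turns the number of edges into a degree sum, at the cost of a factor
    2. *)
Definition arcs : {set G * G} := [set p | adj p.1 p.2].

Lemma card_arcs : #|arcs| = 2 * #|edges G|.
Proof.
rewrite -sum1_card.
rewrite (partition_big (fun p => [set p.1; p.2]) [in edges G]) /=; last first.
  by move=> p; rewrite inE => /mem_edges.
rewrite (eq_bigr (fun=> 2)) ?sum_nat_const ?[_ * 2]mulnC //.
move=> e /edgesP[x [y [xy ->]]].
rewrite (eq_bigl [in [set (x, y); (y, x)]]) ?sum1_card ?cards2.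
  by rewrite xpair_eqE (negPf (adj_neq xy)).
move=> [u v]; rewrite !inE /= !xpair_eqE.
apply/andP/orP => [[uv /eqP euv]|]; last first.
  by case=> /andP[/eqP-> /eqP->]; rewrite ?[adj y x]adj_sym xy // setUC.
have ux : u \in [set x; y] by rewrite -euv set21.
have vx : v \in [set x; y] by rewrite -euv set22.
move: ux vx (adj_neq uv); rewrite !inE.
by do 2!case/orP=> /eqP->; rewrite ?eqxx //; [left|right].
Qed.

Lemma card_pairs (K : rel G) :
  #|[set p : G * G | K p.1 p.2]| = \sum_x #|[set y | K x y]|.
Proof.
rewrite -sum1_card (eq_bigl (fun p => K p.1 p.2)) => [|p]; last by rewrite inE.
rewrite -(pair_big_dep xpredT K (fun _ _ => 1)); apply: eq_bigr => x _.
by rewrite -sum1_card; apply: eq_bigl => y; rewrite inE.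
Qed.

(** The largest adjacency compatible with the barrier: [S] is joined to everything and each block is
    complete. *)
Definition barrier_adj S P : rel G :=
  fun x y => (x != y) && [|| x \in S, y \in S | y \in pblock P x].

(** A degree sum: a vertex of [S] sees all other vertices, and a vertex of a block [C] sees [S] and
    the rest of [C]. *)
Lemma card_barrier_adj S P : partition P (~: S) ->
  #|[set p | barrier_adj S P p.1 p.2]| =
    #|S| * (#|S| + \sum_(C in P) #|C|).-1 +
    \sum_(C in P) #|C| * (#|S| + #|C|.-1).
Proof.
move=> partP; rewrite card_pairs (bigID [in S]) /=; congr (_ + _).
  rewrite -(card_partition partP) cardsC -sum_nat_const.
  apply: eq_bigr => x xS; rewrite -(cardsC1 x); apply: eq_card => y.
  by rewrite !inE /barrier_adj xS andbT eq_sym.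
rewrite (eq_bigl [in ~: S]) => [|x]; last by rewrite inE.
rewrite (set_partition_big _ partP); apply: eq_bigr => C CP.
rewrite -sum_nat_const; apply: eq_bigr => x xC.
have CS : C \subset ~: S := partitionS partP CP.
have xS : x \notin S by rewrite -in_setC (subsetP CS).
have -> : [set y | barrier_adj S P x y] = S :|: C :\ x.
  apply/setP => y; rewrite !inE /barrier_adj (negPf xS) /=.
  rewrite (def_pblock (partition_trivIset partP) CP xC) [y == x]eq_sym.
  by have [<-|] := eqVneq x y; rewrite // (negPf xS).
rewrite cardsU disjoint_setI0 ?cards0 ?subn0 ?(cardsD1 x C) ?xC //.
by rewrite disjoint_sym disjoints_subset (subset_trans (subsetDl _ _)).
Qed.

(** A transversal of the blocks is independent, because adjacent vertices outside [S] share a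
    block. *)
Lemma card_barrier_le S P : partition P (~: S) ->
  {in ~: S &, forall x y, adj x y -> pblock P x = pblock P y} ->
  #|P| <= indep_num G.
Proof.
move=> partP sep.
have trP := transversalP partP.
rewrite -(card_transversal trP); apply: leq_indep_num.
have XS := transversal_sub trP.
apply/independentP => x y xX yX; apply/negP => xy.
have := sep x y (subsetP XS _ xX) (subsetP XS _ yX) xy.
move/(pblock_inj trP xX yX) => exy.
by move: xy; rewrite exy adj_irr.
Qed.

Lemma arcs_sub_barrier S P : partition P (~: S) ->
  {in ~: S &, forall x y, adj x y -> pblock P x = pblock P y} ->
  arcs \subset [set p | barrier_adj S P p.1 p.2].
Proof.
move=> partP sep; apply/subsetP => -[x y]; rewrite !inE /= => xy.
rewrite /barrier_adj (adj_neq xy) /=.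
case: (boolP (x \in S)) => //= xS; case: (boolP (y \in S)) => //= yS.
rewrite (sep x y) ?inE // mem_pblock (cover_partition partP).
by rewrite inE.
Qed.

End Count.

(** * Isomorphisms and the extremal graphs *)

Lemma graph_iso_sym (G H : sgraph) : graph_iso G H -> graph_iso H G.
Proof.
case=> f [g fK gK] fadj; exists g; first by exists f.
by move=> x y; rewrite -fadj !gK.
Qed.

Lemma imset_edge (G H : sgraph) (f : G -> H) (e : {set G}) :
  (forall x y, adj (f x) (f y) = adj x y) ->
  e \in edges G -> f @: e \in edges H.
Proof.
move=> fadj /edgesP[x [y [xy ->]]].
by rewrite imsetU1 imset_set1 mem_edges ?fadj.
Qed.

Lemma leq_indep_num_iso (G H : sgraph) :
  graph_iso G H -> indep_num G <= indep_num H.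
Proof.
case=> f /bij_inj fI fadj; apply/bigmax_leqP => S /independentP iS.
rewrite -(card_imset _ fI); apply/leq_indep_num/independentP.
by move=> _ _ /imsetP[x xS ->] /imsetP[y yS ->]; rewrite fadj iS.
Qed.

Lemma leq_match_num_iso (G H : sgraph) :
  graph_iso G H -> match_num G <= match_num H.
Proof.
case=> f /bij_inj fI fadj; apply/bigmax_leqP => M mM.
rewrite -(card_imset _ (imset_inj fI)); apply/leq_match_num/andP; split.
  apply/subsetP => _ /imsetP[e eM ->].
  exact/(imset_edge fadj)/(matching_edge mM).
by rewrite imset_trivIset //; case/andP: mM.
Qed.

Lemma leq_edges_iso (G H : sgraph) :
  graph_iso G H -> #|edges G| <= #|edges H|.
Proof.
case=> f /bij_inj fI fadj.
rewrite -(card_imset _ (imset_inj fI)); apply: subset_leq_card.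
by apply/subsetP => _ /imsetP[e eE ->]; apply: imset_edge.
Qed.

Lemma indep_num_iso (G H : sgraph) :
  graph_iso G H -> indep_num G = indep_num H.
Proof.
by move=> GH; apply/eqP; rewrite eqn_leq !leq_indep_num_iso //;
   apply: graph_iso_sym.
Qed.

Lemma match_num_iso (G H : sgraph) :
  graph_iso G H -> match_num G = match_num H.
Proof.
by move=> GH; apply/eqP; rewrite eqn_leq !leq_match_num_iso //;
   apply: graph_iso_sym.
Qed.

Lemma card_edges_iso (G H : sgraph) :
  graph_iso G H -> #|edges G| = #|edges H|.
Proof.
by move=> GH; apply/eqP; rewrite eqn_leq !leq_edges_iso //;
   apply: graph_iso_sym.
Qed.

Lemma leq_match_num_fam (G : sgraph) (I : finType) (f g : I -> G) :
  injective f -> injective g -> (forall i j, f i != g j) ->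
  (forall i, adj (f i) (g i)) -> #|I| <= match_num G.
Proof.
move=> fI gI fg fgadj; pose h i := [set f i; g i].
have hx i j x : x \in h i -> x \in h j -> i = j.
  rewrite !inE => /orP[] /eqP-> /orP[].
  - by move/eqP/fI.
  - by rewrite (negPf (fg _ _)).
  - by rewrite eq_sym (negPf (fg _ _)).
  - by move/eqP/gI.
have hI : injective h by move=> i j hij; apply: (hx _ _ (f i)); rewrite -?hij set21.
rewrite -cardsT -(card_imset _ hI); apply/leq_match_num/andP; split.
  by apply/subsetP => _ /imsetP[i _ ->]; apply: mem_edges.
apply/trivIsetP => _ _ /imsetP[i _ ->] /imsetP[j _ ->] neq.
apply/pred0Pn => -[x /andP[/= xi xj]].
by move: neq; rewrite (hx _ _ _ xi xj) eqxx.
Qed.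

(** Every edge of a matching contains a vertex of the cover [S], and disjoint edges contain
    different ones. *)
Lemma match_num_vertex_cover (G : sgraph) (S : {set G}) :
  (forall x y, adj x y -> (x \in S) || (y \in S)) -> match_num G <= #|S|.
Proof.
move=> vc; apply/bigmax_leqP => M mM.
have tI : trivIset M by case/andP: mM.
have -> : #|M| = #|[set pblock M x | x in S :&: cover M]|.
  congr #|pred_of_set _|; apply/setP => e; apply/idP/imsetP => [eM|]; last first.
    by case=> x /setIP[_ xM] ->; apply: pblock_mem.
  have /edgesP[x [y [/vc xy def_e]]] := matching_edge mM eM.
  have [z zS ze] : exists2 z, z \in S & z \in e.
    by case/orP: xy => ?; [exists x|exists y]; rewrite // def_e ?set21 ?set22.
  exists z; last by rewrite (def_pblock tI eM ze).
  by rewrite inE zS; apply/bigcupP; exists e.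
exact: leq_trans (leq_imset_card _ _) (subset_leq_card (subsetIl _ _)).
Qed.

Lemma card_inl_set (A B : finType) : #|[set x : A + B | is_inl x]| = #|A|.
Proof.
rewrite -[RHS]cardsT -(card_imset _ (@inl_inj A B)).
by apply: eq_card => -[x|x]; rewrite !inE; apply/esym;
  [apply/imset_f | apply/imsetP => -[]].
Qed.

Lemma card_inr_set (A B : finType) : #|[set x : A + B | ~~ is_inl x]| = #|B|.
Proof.
rewrite -[RHS]cardsT -(card_imset _ (@inr_inj A B)).
by apply: eq_card => -[x|x]; rewrite !inE; apply/esym;
  [apply/imsetP => -[] | apply/imset_f].
Qed.

(** Labels the vertices by the sum type carrying the model graphs, with [C] going to the left
    summand. *)
Lemma enum_sum_bij (T : finType) (C : {set T}) p q :
  #|C| = p -> #|~: C| = q ->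
  exists f : T -> 'I_p + 'I_q, bijective f /\ forall x, is_inl (f x) = (x \in C).
Proof.
move=> <- <-.
pose g (u : 'I_#|C| + 'I_#|~: C|) : T :=
  match u with inl i => enum_val i | inr j => enum_val j end.
have gC u : (g u \in C) = is_inl u.
  case: u => i /=; first exact: enum_valP.
  by apply/negbTE; rewrite -in_setC; apply: enum_valP.
have gI : injective g.
  move=> u v guv; have : is_inl u = is_inl v by rewrite -!gC guv.
  by case: u v guv => i [j|j] //= /enum_val_inj->.
have gB : bijective g.
  apply: inj_card_bij => //.
  by rewrite card_sum !card_ord cardsC.
case: gB => f gK fK; exists f; split; first by exists g.
by move=> x; rewrite -gC fK.
Qed.

(** * Recognition and parameters of the two extremal graphs *)

Section Models.
Variables a n : nat.

Lemma iso_Ggraph (G : sgraph) (C : {set G}) :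
  #|C| = 2 * n + 1 -> #|~: C| = a - 1 ->
  (forall x y, adj x y = [&& x != y, x \in C & y \in C]) ->
  graph_iso G (Ggraph a n).
Proof.
move=> cC cC' Gadj; have [f [fB fC]] := enum_sum_bij cC cC'.
exists f => // x y; rewrite Gadj -!fC -(inj_eq (bij_inj fB)).
by case: (f x) (f y) => i [j|j] //=; rewrite ?andbT ?andbF.
Qed.

Lemma iso_Hgraph (G : sgraph) (S : {set G}) :
  #|S| = n -> #|~: S| = a ->
  (forall x y, adj x y = (x != y) && ((x \in S) || (y \in S))) ->
  graph_iso G (Hgraph a n).
Proof.
move=> cS cS' Hadj; have cS2 : #|~: ~: S| = n by rewrite setCK.
have [f [fB fS]] := enum_sum_bij cS' cS2.
have fS' x : (x \in S) = ~~ is_inl (f x) by rewrite fS inE negbK.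
exists f => // x y; rewrite Hadj !fS' -(inj_eq (bij_inj fB)).
by case: (f x) (f y) => i [j|j] //=; rewrite ?andbT ?andbF.
Qed.

Lemma indep_num_Ggraph : 0 < a -> indep_num (Ggraph a n) = a.
Proof.
move=> a_gt0; apply/eqP; rewrite eqn_leq; apply/andP; split.
  apply/bigmax_leqP => S /independentP iS.
  pose C : {set Ggraph a n} := [set x | is_inl x].
  rewrite -(cardsID C S).
  have c1 : #|S :&: C| <= 1.
    apply/card_le1_eqP => -[x|x] [y|y]; rewrite !inE ?andbF //= !andbT => xS yS.
    by have /= := iS _ _ xS yS; rewrite negbK => /eqP->.
  have : #|S :\: C| <= a - 1.
    rewrite -[a - 1]card_ord -(card_inr_set 'I_(2 * n + 1)).
    by apply: subset_leq_card; apply/subsetP => x; rewrite !inE => /andP[].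
  by lia.
have o : 0 < 2 * n + 1 by rewrite addn1.
(* One clique vertex together with all [a - 1] isolated vertices. *)
pose S : {set Ggraph a n} := inl (Ordinal o) |: [set x | ~~ is_inl x].
have cS : #|S| = a.
  by rewrite cardsU1 inE (card_inr_set 'I_(2 * n + 1)) card_ord /=; lia.
rewrite -[X in X <= _]cS.
apply/leq_indep_num/independentP => -[x|x] [y|y] //; rewrite !inE ?orbF.
by move=> /eqP-> /eqP->; rewrite adj_irr.
Qed.

Lemma card_arcs_Ggraph : 2 * #|edges (Ggraph a n)| = (2 * n + 1) * (2 * n).
Proof.
rewrite -card_arcs card_pairs big_sumType /= [X in _ + X]big1 ?addn0 => [|x _].
  rewrite (eq_bigr (fun=> 2 * n)) ?sum_nat_const ?card_ord // => x _.
  have cx : #|[set~ x]| = 2 * n by rewrite cardsC1 card_ord addn1.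
  rewrite -[RHS]cx -(card_imset _ (@inl_inj _ 'I_(a - 1))).
  apply: eq_card => -[y|y]; rewrite !inE ?mem_imset ?inE 1?eq_sym //.
    exact: inl_inj.
  by apply/esym/imsetP => -[].
by apply/eqP; rewrite cards_eq0; apply/eqP/setP => -[y|y]; rewrite !inE.
Qed.

Lemma match_num_Ggraph : match_num (Ggraph a n) = n.
Proof.
apply/eqP; rewrite eqn_leq; apply/andP; split.
  apply/bigmax_leqP => M mM.
  have : #|cover M| <= 2 * n + 1.
    rewrite -[2 * n + 1]card_ord -(card_inl_set _ 'I_(a - 1)).
    apply/subset_leq_card/subsetP => x /bigcupP[e eM xe]; rewrite inE.
    by have [y] := edge_at (matching_edge mM eM) xe; case: x {xe}.
  by rewrite card_cover_matching //; lia.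
(* The matching pairs the clique vertices 2i and 2i+1, leaving out only the last vertex 2n. *)
have e0 (i : 'I_n) : 2 * i < 2 * n + 1 by have := ltn_ord i; lia.
have e1 (i : 'I_n) : 2 * i + 1 < 2 * n + 1 by have := ltn_ord i; lia.
rewrite -[n in n <= _]card_ord.
pose f (i : 'I_n) : Ggraph a n := inl (Ordinal (e0 i)).
pose g (i : 'I_n) : Ggraph a n := inl (Ordinal (e1 i)).
apply: (@leq_match_num_fam _ _ f g).
- by move=> i j [] ?; apply: val_inj => /=; lia.
- by move=> i j [] ?; apply: val_inj => /=; lia.
- by move=> i j; apply/eqP => -[] ?; lia.
- by move=> i; apply/eqP => -[] ?; lia.
Qed.

Lemma indep_num_Hgraph : 0 < a -> indep_num (Hgraph a n) = a.
Proof.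
move=> a_gt0; apply/eqP; rewrite eqn_leq; apply/andP; split.
  apply/bigmax_leqP => S /independentP iS.
  (* A vertex of the clique part is adjacent to all others, so an independent set containing it is a
     singleton. *)
  have [/existsP[x xS]|noR] := boolP [exists x, (inr x : Hgraph a n) \in S].
    apply: leq_trans a_gt0; apply/card_le1_eqP.
    suff all z : z \in S -> z = inr x by move=> y z /all-> /all->.
    by case: z => y yS; have := iS _ _ xS yS; rewrite //= negbK => /eqP->.
  rewrite -[a in _ <= a]card_ord -(card_inl_set _ 'I_n).
  apply/subset_leq_card/subsetP => -[x|x] xS; rewrite inE //=.
  by case/negP: noR; apply/existsP; exists x.
rewrite -[a in a <= _]card_ord -(card_inl_set _ 'I_n).
by apply/leq_indep_num/independentP => -[x|x] [y|y]; rewrite !inE.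
Qed.

(** The clique part is a vertex cover of size [n]; since [n <= a], each of its vertices has its own
    partner in the independent part. *)
Lemma match_num_Hgraph : n <= a -> match_num (Hgraph a n) = n.
Proof.
move=> na; apply/eqP; rewrite eqn_leq; apply/andP; split.
  rewrite -[n in _ <= n]card_ord -(card_inr_set 'I_a).
  by apply: match_num_vertex_cover => -[x|x] [y|y] //=; rewrite !inE.
rewrite -[n in n <= _]card_ord.
pose f (i : 'I_n) : Hgraph a n := inl (widen_ord na i).
pose g (i : 'I_n) : Hgraph a n := inr i.
apply: (@leq_match_num_fam _ _ f g) => //.
- by move=> i j [] ?; apply: val_inj.
- by move=> i j [].
Qed.

Lemma card_arcs_Hgraph :
  2 * #|edges (Hgraph a n)| = a * n + n * (a + n.-1).
Proof.
rewrite -card_arcs card_pairs big_sumType /=; congr (_ + _).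
  rewrite (eq_bigr (fun=> n)) ?sum_nat_const ?card_ord // => x _.
  rewrite -[RHS]card_ord -(card_inr_set 'I_a).
  by apply: eq_card => -[y|y]; rewrite !inE.
rewrite (eq_bigr (fun=> a + n.-1)) ?sum_nat_const ?card_ord // => x _.
transitivity #|[set~ (inr x : Hgraph a n)]|.
  by apply: eq_card => -[y|y]; rewrite !inE //= eq_sym.
rewrite cardsC1 card_sum !card_ord; case: n x => [[]//|m _] /=.
by rewrite addnS.
Qed.

End Models.

(** * The extremal bound *)

(* Twice the number of edges of the join of [K_s] with the disjoint union of
   [K_(2(n-s)+1)] and [a-1] isolated vertices. *)
Definition barrier_bound a n s :=
  s * s.-1 + 2 * s * (2 * (n - s) + a) + 2 * (n - s) * (2 * (n - s) + 1).

(** Here [b] stands for the sum of the [#|C|./2] and [k] for the number of blocks. The left side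
    grows with both, and equals the bound at b = n - s, k = a. *)
Lemma barrier_bound_arith a n s b k : s + b <= n -> k <= a ->
  s * (s + (2 * b + k)).-1 + (k * s + 2 * b * (s + 1) + 4 * b * b)
    <= barrier_bound a n s.
Proof.
rewrite /barrier_bound => sbn ka.
have -> : n = s + b + (n - (s + b)) by lia.
move: (n - (s + b)) => d.
have -> : s + b + d - s = b + d by lia.
have -> : a = k + (a - k) by lia.
case: s {sbn} => [|s] /=; nia.
Qed.

(** The degree sum of a block of size at most 2h+1. Replacing one factor of h^2 by the total [b]
    makes the estimate linear in [h], so it can be summed over the blocks. *)
Lemma block_arith s c h b : c <= 2 * h + 1 -> h <= b ->
  c * (s + c.-1) <= s + 2 * h * (s + 1) + 4 * h * b.
Proof.
move=> ch hb.
apply: (@leq_trans ((2 * h + 1) * (s + 2 * h))); last by nia.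
by apply: leq_mul => //; lia.
Qed.

(** An odd [c] is at most 2n - 1, which pays for the rounding in [c./2]. *)
Lemma small_block_arith c n :
  c <= 2 * n -> c * c.-1 <= c./2 * (2 * (2 * n - 1)).
Proof.
move=> cn; rewrite mulnA.
have [e|e] : c = c./2 * 2 \/ c = c./2 * 2 + 1 by lia.
  by rewrite {1}e leq_mul //; lia.
by rewrite mulnC; apply: leq_mul; lia.
Qed.

Section Extremal.
Variable G : sgraph.

Lemma barrier_edges_le (S : {set G}) (P : {set {set G}}) :
  partition P (~: S) -> #|P| <= indep_num G ->
  #|S| + \sum_(C in P) #|C|./2 <= match_num G ->
  #|[set p | barrier_adj S P p.1 p.2]|
    <= barrier_bound (indep_num G) (match_num G) #|S|.
Proof.
move=> partP kP le; rewrite card_barrier_adj //.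
apply: leq_trans (barrier_bound_arith le kP).
set b := \sum_(C in P) #|C|./2.
have wle : \sum_(C in P) #|C| <= 2 * b + #|P|.
  rewrite -sum1_card big_distrr -big_split /=; apply: leq_sum => C _; lia.
apply: leq_add.
  by rewrite leq_mul // -!subn1 leq_sub2r // leq_add2l.
apply: (@leq_trans (\sum_(C in P)
    (#|S| + 2 * #|C|./2 * (#|S| + 1) + 4 * #|C|./2 * b))); last first.
  rewrite !big_split sum_nat_const -!big_distrl -!big_distrr /=; exact: leqnn.
apply: leq_sum => C CP.
apply: block_arith; first by lia.
by rewrite /b (bigD1 C) //= leq_addr.
Qed.

Lemma barrier0_iso_Ggraph (P : {set {set G}}) :
  partition P setT -> 0 < match_num G ->
  \sum_(C in P) #|C|./2 <= match_num G ->
  (forall x y, adj x y = barrier_adj set0 P x y) ->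
  2 * #|edges G| = barrier_bound (indep_num G) (match_num G) 0 ->
  graph_iso G (Ggraph (indep_num G) (match_num G)).
Proof.
move=> partP n_gt0 le Gadj.
have partP0 : partition P (~: set0) by rewrite setC0.
have tI := partition_trivIset partP.
have -> : 2 * #|edges G| = \sum_(C in P) #|C| * #|C|.-1.
  rewrite -card_arcs.
  have -> : arcs G = [set p | barrier_adj set0 P p.1 p.2].
    by apply/setP => p; rewrite !inE Gadj.
  rewrite card_barrier_adj // cards0 mul0n add0n.
  by apply: eq_bigr => C _; rewrite add0n.
set n := match_num G in n_gt0 le *; rewrite /barrier_bound subn0 => cE.
(* If all blocks had at most 2n vertices, the degree sum would be at most 2n(2n-1), less than
   2n(2n+1). A larger block uses up the whole sum of halves, so it has exactly 2n+1 vertices and the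
   others are singletons. *)
have [C CP cC] : exists2 C, C \in P & 2 * n < #|C|.
  apply/exists_inP; apply: contra_eqT cE => /exists_inPn small.
  rewrite neq_ltn; apply/orP; left.
  apply: (@leq_ltn_trans (2 * n * (2 * n - 1))); last by nia.
  apply: (@leq_trans (\sum_(C in P) #|C|./2 * (2 * (2 * n - 1)))); last first.
    rewrite -big_distrl /=; move: le; move: (\sum_(C in P) _) => b; nia.
  by apply: leq_sum => C /small; rewrite -leqNgt; apply: small_block_arith.
have rest : \sum_(D in P | D != C) #|D|./2 <= n - #|C|./2.
  by move: le; rewrite (bigD1 C) //=; lia.
have cC' : #|C| = 2 * n + 1.
  by move: le; rewrite (bigD1 C) //=; lia.
have single D : D \in P -> D != C -> #|D| <= 1.
  by move=> DP DC; move: rest; rewrite (bigD1 D) /= ?DP //; lia.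
have adjC x y : adj x y = [&& x != y, x \in C & y \in C].
  rewrite Gadj /barrier_adj !inE /=; have [//|xy] := eqVneq x y.
  have xP : pblock P x \in P by rewrite pblock_mem ?(cover_partition partP).
  have xx : x \in pblock P x by rewrite mem_pblock (cover_partition partP).
  rewrite /=; apply/idP/andP => [yx|[xC yC]]; last by rewrite (def_pblock tI CP xC).
  have [<- //|] := eqVneq (pblock P x) C => DC.
  have /card_le1_eqP := single _ xP DC.
  by move=> /(_ x y xx yx) e; rewrite e eqxx in xy.
apply: (iso_Ggraph cC') => //.
(* The number of vertices outside [C] is read off the independence number: an independent set meets
   the clique [C] at most once, and one vertex of [C] with everything outside is independent. *)
apply/eqP; rewrite eqn_leq; apply/andP; split; last first.
  rewrite leq_subLR; apply/bigmax_leqP => S /independentP iS.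
  rewrite -(cardsID C S); apply: leq_add.
    apply/card_le1_eqP => x y /setIP[xS xC] /setIP[yS yC].
    by have := iS _ _ xS yS; rewrite adjC xC yC !andbT negbK => /eqP.
  by apply: subset_leq_card; rewrite setDE subsetIr.
have /card_gt0P[c cinC] : 0 < #|C| by rewrite cC' addn1.
have ind : independent (c |: ~: C).
  apply/independentP => x y; rewrite adjC !inE.
  case/orP=> [/eqP->|/negPf-> _]; last by rewrite andbF.
  by case/orP=> [/eqP->|/negPf->]; rewrite ?eqxx ?andbF.
by have := leq_indep_num ind; rewrite cardsU1 !inE cinC /=; lia.
Qed.

Lemma barrier_full_iso_Hgraph (S : {set G}) (P : {set {set G}}) :
  partition P (~: S) -> 0 < match_num G ->
  #|P| <= indep_num G -> #|S| = match_num G ->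
  #|S| + \sum_(C in P) #|C|./2 <= match_num G ->
  (forall x y, adj x y = barrier_adj S P x y) ->
  2 * #|edges G| = barrier_bound (indep_num G) (match_num G) #|S| ->
  graph_iso G (Hgraph (indep_num G) (match_num G)).
Proof.
move=> partP n_gt0 kP cS le Gadj.
have tI := partition_trivIset partP.
(* As [S] alone reaches the matching number, all the [#|D|./2] vanish. *)
have single D : D \in P -> #|D| = 1.
  move=> DP; have : 0 < #|D| by rewrite card_gt0 (partition_neq0 partP).
  by move: le; rewrite (bigD1 D) //=; lia.
have w : #|~: S| = #|P|.
  by rewrite (card_partition partP) -sum1_card; apply: eq_bigr.
have -> : 2 * #|edges G| = #|S| * (#|S| + #|P|).-1 + #|P| * #|S|.
  rewrite -card_arcs.
  have -> : arcs G = [set p | barrier_adj S P p.1 p.2].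
    by apply/setP => p; rewrite !inE Gadj.
  rewrite card_barrier_adj // -(card_partition partP) w; congr (_ + _).
  by rewrite -sum_nat_const; apply: eq_bigr => C /single->; rewrite addn0 mul1n.
rewrite cS /barrier_bound subnn => cE.
apply: (@iso_Hgraph _ _ G S) => //.
  (* The degree sum is strictly increasing in the number of blocks because the matching number is
     positive, so equality forces that number to be the independence number. *)
  rewrite w; apply/eqP; rewrite eqn_leq kP /=.
  move: cE n_gt0; case: (match_num G) => // m /=; nia.
move=> x y; rewrite Gadj /barrier_adj; have [//|xy] := eqVneq x y.
have [//|xS] := boolP (x \in S); have [//|yS] /= := boolP (y \in S).
have xc : x \in cover P by rewrite (cover_partition partP) inE.
have c1 : #|pblock P x| <= 1 by rewrite single ?pblock_mem.
apply/negP => yx; move/card_le1_eqP: c1 => /(_ x y); rewrite mem_pblock.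
by move=> /(_ xc yx) e; rewrite e eqxx in xy.
Qed.

Lemma edges_barrier : 0 < match_num G -> exists s,
  [/\ s <= match_num G,
      2 * #|edges G| <= barrier_bound (indep_num G) (match_num G) s
    & 2 * #|edges G| = barrier_bound (indep_num G) (match_num G) s ->
      (s = 0 -> graph_iso G (Ggraph (indep_num G) (match_num G))) /\
      (s = match_num G -> graph_iso G (Hgraph (indep_num G) (match_num G)))].
Proof.
move=> n_gt0; have [S [P [partP sep le]]] := tutte_berge_barrier G.
have kP := card_barrier_le partP sep.
have sub := arcs_sub_barrier partP sep.
have ub := barrier_edges_le partP kP le.
exists #|S|; split; first exact: leq_trans (leq_addr _ _) le.
  by rewrite -card_arcs (leq_trans (subset_leq_card sub)).
move=> cE.
(* The barrier pairs contain the arcs and number at most the bound, so equality leaves no pair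
   missing. *)
have eqA : arcs G = [set p | barrier_adj S P p.1 p.2].
  by apply/eqP; rewrite eqEcard sub card_arcs cE.
have Gadj x y : adj x y = barrier_adj S P x y.
  by have := congr1 (fun A : {set G * G} => (x, y) \in A) eqA; rewrite !inE.
split=> [/eqP|cS]; last exact: (barrier_full_iso_Hgraph partP).
rewrite cards_eq0 => /eqP S0; move: partP le Gadj cE.
rewrite S0 cards0 add0n setC0 => pP; exact: (barrier0_iso_Ggraph pP n_gt0).
Qed.

End Extremal.

(** * Comparison of the two ends and the theorem *)

Lemma double_bin2 m : 2 * 'C(m, 2) = m * m.-1.
Proof.
by rewrite mul2n bin2 halfK; case: m => //= m; rewrite oddM /= andNb subn0.
Qed.

Lemma barrier_bound_G a n : 2 * 'C(2 * n + 1, 2) = barrier_bound a n 0.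
Proof. by rewrite double_bin2 /barrier_bound addn1 /=; lia. Qed.

Lemma barrier_bound_H a n : 2 * (a * n + 'C(n, 2)) = barrier_bound a n n.
Proof. by rewrite mulnDr double_bin2 /barrier_bound subnn; lia. Qed.

(* The correction term [s * (n - s)] is the strict convexity in [s]. *)
Lemma barrier_bound_ends a n s : s <= n ->
  barrier_bound a n s + s * (n - s + 3 * (n + 1))
    = barrier_bound a n 0 + s * (2 * a).
Proof.
move=> sn; rewrite /barrier_bound.
have -> : n = s + (n - s) by lia.
move: (n - s) => d; rewrite subn0.
have -> : s + d - s = d by lia.
case: s {sn} => [|s] /=; lia.
Qed.

(** The bound at 0 exceeds that at [s] by s(n - s) + s(3(n+1) - 2a), whose two terms are
    nonnegative. *)
Lemma barrier_bound_le_G a n s : s <= n -> 2 * a <= 3 * (n + 1) ->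
  barrier_bound a n s <= barrier_bound a n 0 /\
  (barrier_bound a n s = barrier_bound a n 0 ->
     s = 0 \/ s = n /\ 2 * a = 3 * (n + 1)).
Proof. by move=> sn an; have := barrier_bound_ends a sn; split; nia. Qed.

(** The bound at [n] exceeds that at [s] by (n - s)(2a - 3(n+1) + s). *)
Lemma barrier_bound_le_H a n s : s <= n -> 3 * (n + 1) <= 2 * a ->
  barrier_bound a n s <= barrier_bound a n n /\
  (barrier_bound a n s = barrier_bound a n n ->
     s = n \/ s = 0 /\ 2 * a = 3 * (n + 1)).
Proof.
move=> sn an; have := barrier_bound_ends a sn.
have := barrier_bound_ends a (leqnn n); split; nia.
Qed.

Lemma edges_bound_G a n (G : sgraph) : 0 < n -> 2 * a <= 3 * (n + 1) ->
  indep_num G = a -> match_num G = n ->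
  #|edges G| <= 'C(2 * n + 1, 2) /\
  (#|edges G| = 'C(2 * n + 1, 2) ->
     graph_iso G (Ggraph a n) \/
     2 * a = 3 * (n + 1) /\ graph_iso G (Hgraph a n)).
Proof.
move=> n_gt0 an Ga Gn; have := @edges_barrier G; rewrite Ga Gn.
case=> // s [sn ub eqiso]; have [le eq_le] := barrier_bound_le_G sn an.
have bG := barrier_bound_G a n.
split=> [|cE]; first by lia.
have [|isoG isoH] := eqiso _; first by lia.
case: eq_le => [|/isoG|[/isoH]]; [lia|by left|by right].
Qed.

Lemma edges_bound_H a n (G : sgraph) : 0 < n -> 3 * (n + 1) <= 2 * a ->
  indep_num G = a -> match_num G = n ->
  #|edges G| <= a * n + 'C(n, 2) /\
  (#|edges G| = a * n + 'C(n, 2) ->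
     graph_iso G (Hgraph a n) \/
     2 * a = 3 * (n + 1) /\ graph_iso G (Ggraph a n)).
Proof.
move=> n_gt0 an Ga Gn; have := @edges_barrier G; rewrite Ga Gn.
case=> // s [sn ub eqiso]; have [le eq_le] := barrier_bound_le_H sn an.
have bH := barrier_bound_H a n.
split=> [|cE]; first by lia.
have [|isoG isoH] := eqiso _; first by lia.
case: eq_le => [|/isoH|[/isoG]]; [lia|by left|by right].
Qed.

Lemma card_edges_Ggraph a n : #|edges (Ggraph a n)| = 'C(2 * n + 1, 2).
Proof.
by have := card_arcs_Ggraph a n; have := double_bin2 (2 * n + 1); lia.
Qed.

Lemma card_edges_Hgraph a n : #|edges (Hgraph a n)| = a * n + 'C(n, 2).
Proof. by have := card_arcs_Hgraph a n; have := double_bin2 n; lia. Qed.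

Lemma is_e1_unique a n m m' : is_e1 a n m -> is_e1 a n m' -> m = m'.
Proof.
case=> -[G [Ga Gn <-]] ub [[H [Ha Hn <-]] ub'].
by apply/eqP; rewrite eqn_leq ub' ?ub.
Qed.

Lemma in_E1P a n m (G : sgraph) : is_e1 a n m ->
  in_E1 a n G <-> [/\ indep_num G = a, match_num G = n & #|edges G| = m].
Proof.
move=> em; split=> -[Ga Gn]; last by move=> cE; split; rewrite ?cE.
by move/(is_e1_unique em) <-.
Qed.

Lemma in_E1_iso a n (G H : sgraph) :
  graph_iso G H -> in_E1 a n H -> in_E1 a n G.
Proof.
move=> GH; rewrite /in_E1 (indep_num_iso GH) (match_num_iso GH).
by rewrite (card_edges_iso GH).
Qed.

Theorem theorem16 (a n : nat) (a_gt0 : 0 < a) (n_gt0 : 0 < n) :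
  [/\ 2 * a < 3 * (n + 1) ->
        is_e1 a n 'C(2 * n + 1, 2) /\
        (forall G : sgraph, in_E1 a n G <-> graph_iso G (Ggraph a n)),
      2 * a > 3 * (n + 1) ->
        is_e1 a n (a * n + 'C(n, 2)) /\
        (forall G : sgraph, in_E1 a n G <-> graph_iso G (Hgraph a n))
    & 2 * a = 3 * (n + 1) ->
        [/\ is_e1 a n 'C(2 * n + 1, 2),
            'C(2 * n + 1, 2) = a * n + 'C(n, 2)
          & forall G : sgraph, in_E1 a n G <->
              graph_iso G (Ggraph a n) \/ graph_iso G (Hgraph a n)]].
Proof.
have Ga := indep_num_Ggraph n a_gt0; have Gn := match_num_Ggraph a n.
have Ge := card_edges_Ggraph a n; have Ha := indep_num_Hgraph n a_gt0.
have He := card_edges_Hgraph a n.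
have e1G : 2 * a <= 3 * (n + 1) -> is_e1 a n 'C(2 * n + 1, 2).
  move=> an; split; first by exists (Ggraph a n).
  by move=> G Ga' Gn'; have [] := edges_bound_G n_gt0 an Ga' Gn'.
have e1H : 3 * (n + 1) <= 2 * a -> is_e1 a n (a * n + 'C(n, 2)).
  move=> an; split; last first.
    by move=> G Ga' Gn'; have [] := edges_bound_H n_gt0 an Ga' Gn'.
  (* The hypothesis on [a] gives [n <= a], on which the matching number of H rests. *)
  by exists (Hgraph a n); split=> //; apply: match_num_Hgraph; lia.
have EG : 2 * a <= 3 * (n + 1) -> in_E1 a n (Ggraph a n).
  by move=> an; apply/(in_E1P _ (e1G an)).
have EH : 3 * (n + 1) <= 2 * a -> in_E1 a n (Hgraph a n).
  move=> an; apply/(in_E1P _ (e1H an)); split=> //.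
  by apply: match_num_Hgraph; lia.
split=> an.
- have an' := ltnW an; split=> [|G]; first exact: e1G.
  split=> [/(in_E1P _ (e1G an'))[Ga' Gn' cE]|iso]; last exact: in_E1_iso (EG _).
  (* The other extremal graph would require 2a = 3(n+1), which the strict inequality excludes. *)
  have [_ /(_ cE)[//|[]]] := edges_bound_G n_gt0 an' Ga' Gn'; lia.
- have an' := ltnW an; split=> [|G]; first exact: e1H.
  split=> [/(in_E1P _ (e1H an'))[Ga' Gn' cE]|iso]; last exact: in_E1_iso (EH _).
  have [_ /(_ cE)[//|[]]] := edges_bound_H n_gt0 an' Ga' Gn'; lia.
- have anG : 2 * a <= 3 * (n + 1) by rewrite an.
  have anH : 3 * (n + 1) <= 2 * a by rewrite an.
  split=> [||G]; first exact: e1G.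
    (* Both expressions are the value of e_1, hence equal. *)
    exact: is_e1_unique (e1G anG) (e1H anH).
  split=> [/(in_E1P _ (e1G anG))[Ga' Gn' cE]|[] iso].
  + by have [_ /(_ cE)[|[]]] := edges_bound_G n_gt0 anG Ga' Gn'; [left|right].
  + exact: in_E1_iso (EG _).
  + exact: in_E1_iso (EH _).
Qed.
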